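(* Suppose $F:L^1(0,T)\to\mathbb R$ is Fréchet differentiable and its derivative $\nabla F:L^1(0,T)\to L^\infty(0,T)$ is Lipschitz continuous with constant $L\ge0$. Let $u\in U_{ad}\cap\mathrm{BV}(0,T)$, $j\in\{2,\dots,d\}$ and $0<t_1<t_2<t_3<t_4<T$ be such that $u=\nu_j$ a.e. on $(t_2,t_3)$ and $u<\nu_j$ a.e. on $(t_1,t_2)\cup(t_3,t_4)$. If \[-2\beta-\int_{t_2}^{t_3}\nabla F(u)(s)\,ds+\frac L2(\nu_j-\nu_{j-1})(t_3-t_2)^2<0,\] then $v:=u+(\nu_{j-1}-\nu_j)\chi_{(t_2,t_3)}$ satisfies $F(v)+\beta\mathrm{TV}(v)<F(u)+\beta\mathrm{TV}(u)$.
   Context: $T>0$, $\beta>0$; $\nu_1<\dots<\nu_d$ are integers. $\mathrm{TV}(u):=\sup\{\int_0^T u\varphi'\,dt : \varphi\in C_c^1(0,T),\ \|\varphi\|_\infty\le 1\}$, $\mathrm{BV}(0,T)=\{u\in L^1(0,T):\mathrm{TV}(u)<\infty\}$. $U_{ad}:=\{u\in L^1(0,T): u(t)\in\{\nu_1,\dots,\nu_d\}\text{ a.e.}\}$. $\nabla F(u)\in L^\infty(0,T)$ denotes the function with $F'(u)h=\int_0^T\nabla F(u)h\,dt$ for all $h\in L^1(0,T)$. *)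

(* Defs.v *)
From HB Require Import structures.
From mathcomp Require Import all_boot all_order all_algebra.
From mathcomp Require Import all_classical all_reals all_analysis.
Set Implicit Arguments. Unset Strict Implicit. Unset Printing Implicit Defensive.
Import Order.TTheory GRing.Theory Num.Theory.
Import numFieldNormedType.Exports.
Local Open Scope classical_set_scope.
Local Open Scope ring_scope.

Section Defs.
Variable R : realType.
Notation mu := (@lebesgue_measure R).

(* L^1(0,T): functions integrable on the open interval (0,T);
   only their values on (0,T) matter. *)
Definition isL1 (T : R) (u : R -> R) : Prop :=
  mu.-integrable `]0, T[%classic (EFin \o u).

Definition oitv (T : R) : set R := `]0, T[%classic.

Definition L1norm (T : R) (u : R -> R) : R :=
  fine (\int[mu]_(x in (oitv T)) (`|u x|)%:E)%E.

Definition isLinf (T : R) (g : R -> R) : Prop :=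
  measurable_fun (oitv T) g /\
  exists M : R, {ae mu, forall x, (oitv T) x -> `|g x| <= M}.

(* Frechet differentiability of F on L^1(0,T), with derivative at u
   represented by G u in L^infty: F'(u) h = \int_0^T G u h. *)
Definition frechet_grad (T : R) (F : (R -> R) -> R) (G : (R -> R) -> R -> R)
  : Prop :=
  forall u, isL1 T u ->
    isLinf T (G u) /\
    forall eps : R, 0 < eps -> exists2 delta : R, 0 < delta &
      forall h, isL1 T h -> L1norm T h < delta ->
        `|F (u \+ h) - F u - Rintegral mu (oitv T) (fun x => G u x * h x)|
          <= eps * L1norm T h.

Definition grad_lipschitz (T : R) (G : (R -> R) -> R -> R) (L : R) : Prop :=
  forall u w, isL1 T u -> isL1 T w ->
    {ae mu, forall x, (oitv T) x -> `|G u x - G w x| <= L * L1norm T (u \- w)}.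

(* C_c^1(0,T) test functions (extended by zero) with sup norm <= 1 *)
Definition test_fun (T : R) (phi : R -> R) : Prop :=
  (forall x, derivable phi x 1) /\ continuous (derive1 phi) /\
  (exists a b : R, 0 < a /\ a < b /\ b < T /\
     forall x, ~ (`[a, b]%classic x) -> phi x = 0) /\
  (forall x, `|phi x| <= 1).

Definition TV (T : R) (u : R -> R) : \bar R :=
  ereal_sup [set (Rintegral mu (oitv T) (fun x => u x * derive1 phi x))%:E
            | phi in test_fun T].

Definition isBV (T : R) (u : R -> R) : Prop :=
  isL1 T u /\ (TV T u < +oo)%E.

(* U_ad, with integers nu_1 < ... < nu_d (1-based indexing) *)
Definition Uad (T : R) (d : nat) (nu : nat -> int) (u : R -> R) : Prop :=
  isL1 T u /\
  {ae mu, forall x, (oitv T) x ->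
     exists i : nat, (1 <= i <= d)%N /\ u x = (nu i)%:~R}.

End Defs.

(* Main.v *)
Require Import Defs.
From mathcomp Require Import all_boot all_order all_algebra.
From mathcomp Require Import all_classical all_reals all_analysis.
From mathcomp Require Import measurable_realfun ring lra.
Import Order.TTheory GRing.Theory Num.Theory.
Import numFieldNormedType.Exports.
Local Open Scope classical_set_scope.
Local Open Scope ring_scope.

Set Implicit Arguments.
Unset Strict Implicit.
Unset Printing Implicit Defensive.

(** Write [a = nu_j - nu_(j-1)] and [v = u - a * 1_(t2, t3)]. Along the segment
    from [u] to [v] the Lipschitz gradient gives
    [F v <= F u - a * int_(t2, t3) G u + L / 2 * (a * (t3 - t2))^2].
    Lowering the plateau also lowers the total variation by at least [2 a]: since
    [u] only takes the values [nu_i], [v] has a plateau of height [nu_(j-1)] on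
    [(t2, t3)] and lies below this height on both flanks, so that any test
    function for [v] can be changed near [[t2, t3]], at arbitrarily small cost,
    into one with values [-1] at [t2] and [1] at [t3], and testing [u] with it
    gains [2 a]. The two bounds add up to [a] times the left-hand side of the
    hypothesis, which is negative. *)

Section AeIntegral.
Context d (X : measurableType d) (R : realType).
Variable mu : {measure set X -> \bar R}.
Implicit Types (D : set X) (f g : X -> R).

Lemma ae_le_integrable D f g :
  measurable D -> measurable_fun D f -> mu.-integrable D (EFin \o g) ->
  {ae mu, forall x, D x -> `|f x| <= g x} -> mu.-integrable D (EFin \o f).
Proof.
move=> mD mf ig le_fg; apply/integrableP; split; first exact/measurable_EFinP.
have /integrableP[/measurable_EFinP mg] := ig.
apply: le_lt_trans; apply: ae_ge0_le_integral => //.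
- exact/measurable_EFinP/measurableT_comp.
- exact/measurable_EFinP/measurableT_comp.
- apply: filterS le_fg => x + Dx => /(_ Dx) fg.
  by rewrite lee_fin (le_trans fg)// ler_norm.
Qed.

Lemma ae_le_Rintegral D f g :
  measurable D -> mu.-integrable D (EFin \o f) ->
  mu.-integrable D (EFin \o g) ->
  {ae mu, forall x, D x -> f x <= g x} ->
  \int[mu]_(x in D) f x <= \int[mu]_(x in D) g x.
Proof.
move=> mD intf intg le_fg; rewrite -subr_ge0 -RintegralB//.
have [/measurable_EFinP mf _] := integrableP _ _ _ intf.
have [/measurable_EFinP mg _] := integrableP _ _ _ intg.
suff -> : \int[mu]_(x in D) (g x - f x) = \int[mu]_(x in D) `|g x - f x|.
  exact: Rintegral_ge0.
have mgf : measurable_fun D (g \- f) by exact: measurable_funB.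
congr fine; apply: ae_eq_integral => //.
- exact/measurable_EFinP.
- exact/measurable_EFinP/measurableT_comp.
- by apply: filterS le_fg => x + Dx => /(_ Dx) fg; rewrite ger0_norm ?subr_ge0.
Qed.

Lemma Rintegral_normr_abs_continuous D f (e : R) :
  measurable D -> mu.-integrable D (EFin \o f) -> 0 < e ->
  exists2 delta : R, 0 < delta & forall A, measurable A -> A `<=` D ->
    (mu A < delta%:E)%E -> \int[mu]_(x in A) `|f x| < e.
Proof.
move=> mD intf e0.
have intfD : mu.-integrable setT (EFin \o (f \_ D)).
  by rewrite -restrict_EFin; apply/integrable_restrict; rewrite ?setTI.
have [delta [delta0 small]] := integral_normr_continuous intfD e0.
exists delta => // A mA AD /(small _ mA).
rewrite (@eq_Rintegral _ _ _ _ _ (fun x => `|f x|))// => x /set_mem Ax.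
by rewrite patchE mem_set//; exact: AD.
Qed.

End AeIntegral.

(* Instance resolution misses this filter because [R] is not syntactically the
   measurable type [measurableTypeR R]. *)
#[local] Instance ae_lebesgue_filter (R : realType) :
  Filter (almost_everywhere (@lebesgue_measure R)) :=
  ae_filter_ringOfSetsType (@lebesgue_measure R).

Lemma ae_neq (R : realType) (c : R) :
  {ae @lebesgue_measure R, forall x, x != c}.
Proof.
exists [set c]; split; [exact: measurable_set1|exact: lebesgue_measure_set1|].
by move=> x /= /negP; rewrite negbK => /eqP.
Qed.

Section Pairing.
Context {R : realType}.
Variable T : R.
Notation mu := (@lebesgue_measure R).
Implicit Types (c k M : R) (u h g : R -> R).

Definition pairing g h : R := \int[mu]_(x in oitv T) (g x * h x).

Lemma measurable_oitv : measurable (oitv T : set (measurableTypeR R)).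
Proof. exact: measurable_itv. Qed.
Local Hint Resolve measurable_oitv : core.

Lemma isL1D u h : isL1 T u -> isL1 T h -> isL1 T (u \+ h).
Proof. by move=> iu ih; apply: eq_integrable (integrableD _ iu ih). Qed.

Lemma isL1Z k h : isL1 T h -> isL1 T (k \*o h).
Proof. by move=> ih; apply: eq_integrable (integrableZl _ k ih). Qed.

Lemma isL1_norm h : isL1 T h -> isL1 T (fun x => `|h x|).
Proof. exact: (@integrable_norm _ (measurableTypeR R)). Qed.

Lemma isL1_continuous g : continuous g -> isL1 T g.
Proof.
move=> cg; apply: (@integrableS _ (measurableTypeR R) R mu `[0, T]%classic) => //.
  exact: subset_itv_oo_cc.
apply: continuous_compact_integrable; first exact: segment_compact.
exact: continuous_subspaceT.
Qed.

Lemma L1norm_ge0 h : 0 <= L1norm T h.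
Proof. by apply: fine_ge0; exact: integral_ge0. Qed.

Lemma L1normZ k h : isL1 T h -> L1norm T (k \*o h) = `|k| * L1norm T h.
Proof.
move=> ih; rewrite -[RHS]RintegralZl//; last exact: integrable_norm.
by apply: eq_Rintegral => x _; rewrite normrM.
Qed.

Lemma isLinfB g h : isLinf T g -> isLinf T h -> isLinf T (g \- h).
Proof.
move=> [mg [M gM]] [mh [N hN]]; split.
  exact: (@measurable_funB _ (measurableTypeR R)).
exists (M + N); apply: filterS2 gM hN => x + + Tx => /(_ Tx) gM /(_ Tx) hN.
by rewrite (le_trans (ler_normB _ _))// lerD.
Qed.

Lemma isLinf_continuous g : continuous g -> isLinf T g.
Proof.
move=> cg; split; first by apply: measurable_funS (continuous_measurable_fun cg).
have /compact_bounded[M [_ gM]] : compact (g @` `[0, T]%classic).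
  apply: continuous_compact; last exact: segment_compact.
  exact: continuous_subspaceT.
exists (M + 1); apply: aeW => x Tx; apply: gM; first by rewrite ltrDl.
by exists x => //; apply: subset_itv_oo_cc.
Qed.

Lemma isL1_mul g h : isLinf T g -> isL1 T h -> isL1 T (g \* h).
Proof.
move=> [mg [M gM]] ih.
have /integrableP[/measurable_EFinP mh _] := ih.
apply: (@ae_le_integrable _ (measurableTypeR R) R mu (oitv T) _
  (M \*o fun x => `|h x|)) => //.
- exact: (@measurable_funM _ (measurableTypeR R)).
- exact/isL1Z/isL1_norm.
- apply: filterS gM => x + Tx => /(_ Tx) gM.
  by rewrite normrM ler_wpM2r.
Qed.

Lemma isLinf_indic (A : set R) : measurable A -> isLinf T \1_A.
Proof.
move=> mA; split; first exact: measurable_indic.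
exists 1; apply: aeW => x _; rewrite indicE.
by case: (_ \in _); rewrite ?normr1 ?normr0.
Qed.

Lemma isL1_indic (A : set R) : measurable A -> isL1 T \1_A.
Proof.
move=> mA; have i1 := isL1_continuous (@cst_continuous R R 1).
apply: eq_integrable (isL1_mul (isLinf_indic mA) i1) => //.
by move=> x _ /=; rewrite mulr1.
Qed.

Lemma isL1_indic_itvoo (a b : R) : isL1 T \1_(`]a, b[%classic).
Proof. by apply: isL1_indic; exact: measurable_itv. Qed.

Lemma pairingC g h : pairing g h = pairing h g.
Proof. by apply: eq_Rintegral => x _; rewrite mulrC. Qed.

Lemma pairingDr g u h : isLinf T g -> isL1 T u -> isL1 T h ->
  pairing g (u \+ h) = pairing g u + pairing g h.
Proof.
move=> ig iu ih; rewrite /pairing -RintegralD//; [|exact: isL1_mul..].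
by apply: eq_Rintegral => x _; rewrite mulrDr.
Qed.

Lemma pairingZr g k h : isLinf T g -> isL1 T h ->
  pairing g (k \*o h) = k * pairing g h.
Proof.
move=> ig ih; rewrite /pairing -RintegralZl//; last exact: isL1_mul.
by apply: eq_Rintegral => x _; rewrite mulrCA.
Qed.

Lemma pairingBl g h u : isLinf T g -> isLinf T h -> isL1 T u ->
  pairing (g \- h) u = pairing g u - pairing h u.
Proof.
move=> ig ih iu; rewrite /pairing -RintegralB//; [|exact: isL1_mul..].
by apply: eq_Rintegral => x _; rewrite mulrBl.
Qed.

Lemma pairing_indic g (A : set R) : A `<=` oitv T ->
  pairing g \1_A = \int[mu]_(x in A) g x.
Proof.
move=> /setIidPr AT; rewrite -[in RHS]AT Rintegral_mkcondr.
apply: eq_Rintegral => x _; rewrite patchE indicE.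
by case: ifP; rewrite ?mulr1 ?mulr0.
Qed.

Lemma itvoo_sub_oitv (a b : R) : 0 <= a -> b <= T -> `]a, b[%classic `<=` oitv T.
Proof. by move=> a0 bT; apply: subset_itv; rewrite bnd_simp. Qed.

Lemma L1norm_indic_itvoo (a b : R) : 0 <= a -> a <= b -> b <= T ->
  L1norm T \1_(`]a, b[%classic) = b - a.
Proof.
move=> a0 ab bT; transitivity (pairing (fun=> 1) \1_(`]a, b[%classic)).
  by apply: eq_Rintegral => x _; rewrite mul1r ger0_norm.
rewrite pairing_indic; last exact: itvoo_sub_oitv.
rewrite Rintegral_cst//= lebesgue_measure_itv/= lte_fin.
by case: ltgtP ab => //= [_|->] _; rewrite mul1r ?subrr.
Qed.

Lemma ler_pairing g h M : isLinf T g -> isL1 T h ->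
  {ae mu, forall x, oitv T x -> `|g x| <= M} -> pairing g h <= M * L1norm T h.
Proof.
move=> ig ih gM.
have -> : M * L1norm T h = \int[mu]_(x in oitv T) (M * `|h x|).
  by rewrite RintegralZl//; exact: isL1_norm.
apply: ae_le_Rintegral => //; [exact: isL1_mul|exact/isL1Z/isL1_norm|].
apply: filterS gM => x + Tx => /(_ Tx) gM.
by rewrite (le_trans (ler_norm _))// normrM ler_wpM2r.
Qed.

End Pairing.
#[local] Hint Resolve measurable_oitv : core.

Lemma is_derive1_remainder (R : realType) (f : R -> R) (x l : R) :
  (forall eps : R, 0 < eps -> exists2 delta : R, 0 < delta &
    forall s, `|s| < delta -> `|f (x + s) - f x - s * l| <= eps * `|s|) ->
  is_derive x 1 f l.
Proof.
move=> fl.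
have cvfl : (fun s => s^-1 *: (f (s *: 1 + x) - f x)) @ (0 : R)^' --> l.
  apply/cvgrPdist_le => /= e e0; have [delta d0 {}fl] := fl _ e0.
  exists delta => //= s; rewrite /ball_ /= sub0r normrN => sd s0.
  rewrite -[l](mulKf s0) -mulrBr normrM normfV ler_pdivrMl ?normr_gt0//.
  by rewrite [_ *: 1]mulr1 -normrN opprB [s + x]addrC [`|s| * e]mulrC; exact: fl.
by apply: DeriveDef; [exact: cvgP cvfl|exact: cvg_lim cvfl].
Qed.

Section Descent.
Context {R : realType}.
Variables (T L : R) (F : (R -> R) -> R) (G : (R -> R) -> R -> R).
Hypotheses (FG : frechet_grad T F G) (GL : grad_lipschitz T G L).
Implicit Types (t : R) (u w h : R -> R).

Lemma frechet_is_derive u h t : isL1 T u -> isL1 T h ->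
  is_derive t 1 (fun s => F (u \+ (s \*o h))) (pairing T (G (u \+ (t \*o h))) h).
Proof.
move=> iu ih; have iw : isL1 T (u \+ (t \*o h)) by apply: isL1D => //; exact: isL1Z.
have [Gw dFw] := FG iw.
apply: is_derive1_remainder => eps eps0.
have N0 : 0 < L1norm T h + 1 by rewrite ltr_wpDl ?L1norm_ge0.
have [|delta delta0 remF] := dFw (eps / (L1norm T h + 1)); first exact: divr_gt0.
exists (delta / (L1norm T h + 1)) => [|s]; first exact: divr_gt0.
rewrite ltr_pdivlMr// => s_lt.
have sN : `|s| * L1norm T h <= `|s| * (L1norm T h + 1).
  by rewrite ler_wpM2l// lerDl.
have -> : u \+ ((t + s) \*o h) = (u \+ (t \*o h)) \+ (s \*o h).
  by apply/funext => x /=; rewrite mulrDl addrA.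
have := remF _ (isL1Z s ih); rewrite (L1normZ _ ih).
rewrite -/(pairing T _ _) pairingZr// => /(_ (le_lt_trans sN s_lt)).
move=> /le_trans; apply.
by rewrite -mulrA ler_pM2l// ler_pdivrMl// [leRHS]mulrC.
Qed.

Lemma grad_pairing_le u w h : isL1 T u -> isL1 T w -> isL1 T h ->
  pairing T (G w) h <= pairing T (G u) h + L * L1norm T (w \- u) * L1norm T h.
Proof.
move=> iu iw ih; have [Gu _] := FG iu; have [Gw _] := FG iw.
rewrite -lerBlDl -pairingBl//; apply: ler_pairing => //; first exact: isLinfB.
exact: GL.
Qed.

Lemma descent_lemma u h : isL1 T u -> isL1 T h ->
  F (u \+ h) <= F u + pairing T (G u) h + L / 2 * L1norm T h ^+ 2.
Proof.
move=> iu ih; pose w t := u \+ (t \*o h); pose N := L1norm T h.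
have iw t : isL1 T (w t) by apply: isL1D => //; exact: isL1Z.
have w0 : w 0 = u by apply/funext => x; rewrite /w/= mul0r addr0.
have w1 : w 1 = u \+ h by apply/funext => x; rewrite /w/= mul1r.
pose dF t := pairing T (G (w t)) h.
pose gap t := F (w t) - dF 0 * t - L / 2 * N ^+ 2 * (t * t).
have dgap t : is_derive t 1 gap (dF t - dF 0 - L * t * N ^+ 2).
  have dFw : is_derive t 1 (F \o w) (dF t) by exact: frechet_is_derive.
  have -> : gap = (F \o w) - dF 0 *: @id R - (L / 2 * N ^+ 2) *: (@id R * @id R).
    by apply/funext.
  by apply: is_derive_eq; rewrite /GRing.scale /= !mulr1; lra.
have cgap : {within `[0, 1]%classic, continuous gap}.
  apply: derivable_within_continuous => t _.
  exact: (ex_derive (is_derive := dgap t)).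
have [t t01] := MVT ltr01 (fun t _ => dgap t) cgap.
rewrite subr0 mulr1 /gap w0 w1 => gapE.
have t0 : 0 <= t by rewrite (itvP t01).
have := grad_pairing_le iu (iw t) ih.
have -> : w t \- u = t \*o h by apply/funext => x; rewrite /w/=; ring.
have dF0 : dF 0 = pairing T (G u) h by rewrite /dF w0.
rewrite (L1normZ _ ih) (ger0_norm t0) -/(dF t) -/N -dF0; lra.
Qed.

Lemma descent_indic_itvoo u (a b c : R) :
  isL1 T u -> 0 <= a -> a <= b -> b <= T ->
  F (u \+ (c \*o \1_(`]a, b[%classic))) <=
  F u + c * \int[lebesgue_measure]_(x in `]a, b[) G u x +
  L / 2 * (c * (b - a)) ^+ 2.
Proof.
move=> iu a0 ab bT; have [Gu _] := FG iu.
have iI := isL1_indic_itvoo T a b.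
have := descent_lemma iu (isL1Z c iI).
rewrite pairingZr// pairing_indic; last exact: itvoo_sub_oitv.
rewrite L1normZ// L1norm_indic_itvoo//.
by rewrite !exprMn real_normK ?num_real.
Qed.

End Descent.

Section C1.
Context {R : realType}.
Implicit Types (f df g dg e de : R -> R) (a b c d x : R).

Definition C1_derive f df :=
  (forall x, is_derive x 1 f (df x)) /\ continuous df.

Lemma C1_derive_eq f df dg : C1_derive f df -> df =1 dg -> C1_derive f dg.
Proof. by move=> + /funext <-. Qed.

Lemma C1_derive_continuous f df : C1_derive f df -> continuous f.
Proof.
move=> [fd _] x; apply: differentiable_continuous.
by apply/derivable1_diffP; exact: ex_derive.
Qed.

Lemma C1_derive_derive1 f df : C1_derive f df -> f^`()%classic = df.
Proof.
by move=> [fd _]; apply/funext => x; rewrite derive1E; exact: derive_val.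
Qed.

Lemma C1_derive_cst c : C1_derive (fun=> c) (fun=> 0).
Proof. by split=> x; [exact: is_derive_cst|exact: cvg_cst]. Qed.

Lemma C1_derive_id : C1_derive id (fun=> 1).
Proof. by split=> x; [exact: is_derive_id|exact: cvg_cst]. Qed.

Lemma C1_deriveD f df g dg : C1_derive f df -> C1_derive g dg ->
  C1_derive (fun x => f x + g x) (fun x => df x + dg x).
Proof.
move=> [fd cf] [gd cg]; split=> x; first exact: is_deriveD.
by apply: cvgD; [exact: cf|exact: cg].
Qed.

Lemma C1_deriveB f df g dg : C1_derive f df -> C1_derive g dg ->
  C1_derive (fun x => f x - g x) (fun x => df x - dg x).
Proof.
move=> [fd cf] [gd cg]; split=> x; first exact: is_deriveB.
by apply: cvgB; [exact: cf|exact: cg].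
Qed.

Lemma C1_deriveM f df g dg : C1_derive f df -> C1_derive g dg ->
  C1_derive (fun x => f x * g x) (fun x => df x * g x + f x * dg x).
Proof.
move=> Cf Cg; have [fd cf] := Cf; have [gd cg] := Cg; split=> x.
  have -> : df x * g x + f x * dg x = f x *: dg x + g x *: df x.
    by rewrite addrC [g x *: _]mulrC.
  exact: is_deriveM.
apply: cvgD; apply: cvgM; [exact: cf|exact: (C1_derive_continuous Cg)
  |exact: (C1_derive_continuous Cf)|exact: cg].
Qed.

Lemma C1_deriveV f df : C1_derive f df -> (forall x, f x != 0) ->
  C1_derive (fun x => (f x)^-1) (fun x => - f x ^- 2 * df x).
Proof.
move=> Cf f0; have [fd cf] := Cf; split=> x; first exact: is_deriveV.
apply: cvgM; last exact: cf.
apply: cvgN; apply: cvgV; first exact: expf_neq0.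
by apply: (@continuous_comp _ _ _ f (@GRing.exp R ^~ 2%N));
  [exact: (C1_derive_continuous Cf)|exact: exprn_continuous].
Qed.

Lemma C1_derive_comp f df g dg : C1_derive f df -> C1_derive g dg ->
  C1_derive (fun x => f (g x)) (fun x => df (g x) * dg x).
Proof.
move=> [fd cf] Cg; have [gd cg] := Cg; split=> x.
  exact: (is_derive1_comp (fd (g x)) (gd x)).
apply: cvgM; last exact: cg.
by apply: continuous_comp; [exact: (C1_derive_continuous Cg)|exact: cf].
Qed.

Lemma C1_derive_Rintegral f df a b : a < b -> C1_derive f df ->
  \int[lebesgue_measure]_(x in `]a, b[) df x = f b - f a.
Proof.
move=> ab Cf; have [fd cdf] := Cf.
have cdf_ab : {within `[a, b]%classic, continuous df}.
  exact: continuous_subspaceT.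
have icc : lebesgue_measure.-integrable `[a, b]%classic (EFin \o df).
  by apply: continuous_compact_integrable => //; exact: segment_compact.
have ico : lebesgue_measure.-integrable `[a, b[%classic (EFin \o df).
  by apply: integrableS icc => //; exact: subset_itv_co_cc.
have ioo : lebesgue_measure.-integrable `]a, b[%classic (EFin \o df).
  by apply: integrableS icc => //; exact: subset_itv_oo_cc.
rewrite Rintegral_itv_obnd_cbnd// Rintegral_itv_bndo_bndc//.
rewrite /Rintegral (@continuous_FTC2 _ _ f)//.
- have cvf x : f y @[y --> x] --> f x by exact: (C1_derive_continuous Cf).
  split=> [x _||]; first exact: ex_derive.
  + exact: cvg_at_right_filter.
  + exact: cvg_at_left_filter.
- by move=> x _; rewrite (C1_derive_derive1 Cf).
Qed.

Lemma C1_derive_sqr_pos :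
  C1_derive (fun x => Num.max x 0 ^+ 2) (fun x => 2 * Num.max x 0).
Proof.
split=> x; last first.
  apply: cvgM; first exact: cvg_cst.
  by apply: continuous_max; [exact: cvg_id|exact: cvg_cst].
apply: is_derive1_remainder => eps eps0; exists eps => // s s_lt.
have le_sqr : `|Num.max (x + s) 0 ^+ 2 - Num.max x 0 ^+ 2 - s * (2 * Num.max x 0)|
    <= `|s| ^+ 2.
  rewrite real_normK ?num_real// ler_norml.
  by case: (leP x 0) => x0; case: (leP (x + s) 0) => xs0; apply/andP; split; nra.
by apply: le_trans le_sqr _; rewrite expr2 ler_wpM2r// ltW.
Qed.

Definition is_ramp a b f df : Prop :=
  [/\ C1_derive f df, forall x, 0 <= f x <= 1, forall x, 0 <= df x,
    forall x, x <= a -> f x = 0 /\ df x = 0 &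
    forall x, b <= x -> f x = 1 /\ df x = 0].

(* The ramp is [p / (p + q)] with [p] and [q] the squares of the positive parts of
   [x - a] and [b - x], which never vanish together. *)
Lemma exists_ramp a b : a < b -> exists f df, is_ramp a b f df.
Proof.
move=> ab; pose p x := Num.max (x - a) 0 ^+ 2; pose q x := Num.max (b - x) 0 ^+ 2.
pose dp x := 2 * Num.max (x - a) 0; pose dq x := - (2 * Num.max (b - x) 0).
have Cp : C1_derive p dp.
  apply: C1_derive_eq (C1_derive_comp C1_derive_sqr_pos
    (C1_deriveB C1_derive_id (C1_derive_cst a))) _ => x.
  by rewrite subr0 mulr1.
have Cq : C1_derive q dq.
  apply: C1_derive_eq (C1_derive_comp C1_derive_sqr_pos
    (C1_deriveB (C1_derive_cst b) C1_derive_id)) _ => x.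
  by rewrite sub0r mulrN1.
have p0 x : 0 <= p x by exact: sqr_ge0.
have q0 x : 0 <= q x by exact: sqr_ge0.
have dp0 x : 0 <= dp x by rewrite mulr_ge0// le_max lexx orbT.
have dq0 x : dq x <= 0 by rewrite oppr_le0 mulr_ge0// le_max lexx orbT.
have p_left x : x <= a -> p x = 0 /\ dp x = 0.
  by move=> xa; rewrite /p /dp max_r ?subr_le0// expr0n mulr0.
have q_right x : b <= x -> q x = 0 /\ dq x = 0.
  by move=> bx; rewrite /q /dq max_r ?subr_le0// expr0n mulr0 oppr0.
have pq0 x : 0 < p x + q x.
  have [xa|ax] := leP x a.
    by rewrite ltr_wpDl// exprn_gt0// lt_max subr_gt0 (le_lt_trans xa ab).
  by rewrite ltr_wpDr// exprn_gt0// lt_max subr_gt0 ax.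
have pq_neq0 x : p x + q x != 0 by rewrite gt_eqF.
exists (fun x => p x / (p x + q x)).
exists (fun x => (dp x * q x - p x * dq x) / (p x + q x) ^+ 2).
split=> [|x|x|x xa|x bx].
- have CV := C1_deriveV (C1_deriveD Cp Cq) pq_neq0.
  by apply: C1_derive_eq (C1_deriveM Cp CV) _ => x; field.
- by rewrite divr_ge0 ?(ltW (pq0 x))//= ler_pdivrMr// mul1r lerDl.
- rewrite divr_ge0 ?sqr_ge0// subr_ge0.
  by rewrite (le_trans (mulr_ge0_le0 (p0 x) (dq0 x)))// mulr_ge0.
- by have [-> ->] := p_left x xa; rewrite !mul0r subrr mul0r.
- have [qx ->] := q_right x bx; move: (pq_neq0 x); rewrite qx addr0 => px0.
  by rewrite divff// !mulr0 subrr mul0r.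
Qed.

Definition is_bump c a b d e de : Prop :=
  [/\ C1_derive e de, forall x, 0 <= e x <= 1,
    forall x, x <= c \/ d <= x -> e x = 0 /\ de x = 0,
    forall x, a <= x <= b -> e x = 1 &
    (forall x, x <= a -> 0 <= de x) /\ (forall x, b <= x -> de x <= 0)].

Lemma exists_bump c a b d : c < a -> a <= b -> b < d ->
  exists e de, is_bump c a b d e de.
Proof.
move=> ca ab bd.
have [f [df [Cf f01 df0 f_left f_right]]] := exists_ramp ca.
have [g [dg [Cg g01 dg0 g_left g_right]]] := exists_ramp bd.
exists (fun x => f x - g x), (fun x => df x - dg x); split=> [|x|x|x|].
- exact: C1_deriveB.
- have [xb|/ltW bx] := leP x b; first by rewrite (g_left x xb).1 subr0.
  by rewrite (f_right x (le_trans ab bx)).1; have := g01 x; lra.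
- case=> [xc|dx].
    have xb : x <= b by lra.
    by have [-> ->] := f_left x xc; have [-> ->] := g_left x xb; rewrite subrr.
  have ax : a <= x by lra.
  by have [-> ->] := f_right x ax; have [-> ->] := g_right x dx; rewrite !subrr.
- by move=> /andP[ax xb]; rewrite (f_right x ax).1 (g_left x xb).1 subr0.
- split=> x x_out.
    by rewrite (g_left x (le_trans x_out ab)).2 subr0.
  by rewrite (f_right x (le_trans ab x_out)).2 sub0r oppr_le0.
Qed.

End C1.

Section TotalVariation.
Context {R : realType}.
Variable T : R.
Notation mu := (@lebesgue_measure R).
Implicit Types (v f df phi psi : R -> R).

Lemma test_fun_C1_derive phi : test_fun T phi -> C1_derive phi phi^`()%classic.
Proof.
by move=> [dphi [cphi _]]; split=> // x; rewrite derive1E; exact: DeriveDef.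
Qed.

Lemma C1_derive_test_fun f df (a b : R) :
  C1_derive f df -> 0 < a -> a < b -> b < T ->
  (forall x, x < a -> f x = 0) -> (forall x, b < x -> f x = 0) ->
  (forall x, `|f x| <= 1) -> test_fun T f.
Proof.
move=> Cf a0 ab bT fa fb f1; have [fd cdf] := Cf.
split; [by []|split; [by rewrite (C1_derive_derive1 Cf)|split; [|by []]]].
exists a, b; split; [|split; [|split]] => // x.
by rewrite /= in_itv/= => /negP; rewrite negb_and -!ltNge => /orP[/fa|/fb].
Qed.

Lemma test_fun_support phi : test_fun T phi -> exists a b : R,
  [/\ 0 < a, a < b, b < T,
    forall x, x < a -> phi x = 0 & forall x, b < x -> phi x = 0].
Proof.
move=> [_ [_ [[a [b [a0 [ab [bT phi0]]]]] _]]]; exists a, b; split=> // x x_out.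
  by apply: phi0; rewrite /= in_itv/= => /andP[]; rewrite leNgt x_out.
by apply: phi0; rewrite /= in_itv/= => /andP[_]; rewrite leNgt x_out.
Qed.

Lemma test_fun_derive1_isLinf phi : test_fun T phi -> isLinf T phi^`()%classic.
Proof. by move=> [_ [cphi _]]; exact: isLinf_continuous. Qed.

Lemma test_fun_pairing_cst phi (c : R) : test_fun T phi ->
  pairing T phi^`()%classic (fun=> c) = 0.
Proof.
move=> tphi; have [a [b [a0 ab bT phi_a phi_b]]] := test_fun_support tphi.
have [_ [cphi _]] := tphi.
rewrite /pairing RintegralZr//; last exact: isL1_continuous.
rewrite (C1_derive_Rintegral _ (test_fun_C1_derive tphi)); last lra.
by rewrite (phi_a 0)// (phi_b T)// subrr mul0r.
Qed.

Lemma pairing_le_TV v phi : test_fun T phi ->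
  ((pairing T v phi^`()%classic)%:E <= TV T v)%E.
Proof. by move=> tphi; apply: ereal_sup_ubound; exists phi. Qed.

Lemma TV_ge0 v : 0 < T -> (0 <= TV T v)%E.
Proof.
move=> T0; have test0 : test_fun T (fun=> 0).
  by apply: (@C1_derive_test_fun _ _ (T / 4) (T / 2) (C1_derive_cst 0)) => //;
    rewrite ?normr0//; lra.
have := pairing_le_TV v test0; rewrite (C1_derive_derive1 (C1_derive_cst 0)).
rewrite /pairing; under eq_Rintegral do rewrite mulr0.
by rewrite Rintegral_cst ?mul0r.
Qed.

Lemma test_fun_interpolate phi e de g dg (c d : R) :
  test_fun T phi -> C1_derive e de -> C1_derive g dg ->
  0 < c -> d < T -> (forall x, x <= c \/ d <= x -> e x = 0) ->
  (forall x, 0 <= e x <= 1) -> (forall x, `|g x| <= 1) ->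
  test_fun T (fun x => phi x + e x * (g x - phi x)).
Proof.
move=> tphi Ce Cg c0 dT e0 e01 g1; have Cphi := test_fun_C1_derive tphi.
have [a [b [a0 ab bT phi_a phi_b]]] := test_fun_support tphi.
have [_ [_ [_ phi1]]] := tphi.
have Cpsi := C1_deriveD Cphi (C1_deriveM Ce (C1_deriveB Cg Cphi)).
apply: (@C1_derive_test_fun _ _ (Num.min a c) (Num.max b d) Cpsi).
- by rewrite lt_min a0.
- by rewrite gt_min !lt_max ab.
- by rewrite gt_max bT.
- move=> x; rewrite lt_min => /andP[xa /ltW xc].
  by rewrite phi_a// e0 ?mul0r ?addr0//; left.
- move=> x; rewrite gt_max => /andP[bx /ltW dx].
  by rewrite phi_b// e0 ?mul0r ?addr0//; right.
- move=> x.
  have -> : phi x + e x * (g x - phi x) = (1 - e x) * phi x + e x * g x by ring.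
  have /andP[ex0 ex1] := e01 x; rewrite (le_trans (ler_normD _ _))// !normrM.
  rewrite (ger0_norm ex0) ger0_norm ?subr_ge0// -[leRHS](subrK (e x)).
  by rewrite lerD// ler_piMr// subr_ge0.
Qed.

(* [psi = phi + e * (g - phi)] with [e] a bump equal to 1 on [[a, b]] and [g] rising
   from -1 to 1 on [[a, b]]. Outside of [[a, b]] the term [e' * (g - phi)] of the
   derivative is nonpositive because [phi] lies between -1 and 1. *)
Lemma exists_test_fun_rising phi (c a b d : R) :
  test_fun T phi -> 0 < c -> c < a -> a < b -> b < d -> d < T ->
  exists psi, [/\ test_fun T psi, psi a = -1, psi b = 1,
    forall x, x <= c \/ d <= x -> psi^`()%classic x = phi^`()%classic x &
    forall x, x <= a \/ b <= x ->
      psi^`()%classic x - phi^`()%classic x <= `|phi^`()%classic x| ].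
Proof.
move=> tphi c0 ca ab bd dT; have [_ [_ [_ phi1]]] := tphi.
have [e [de [Ce e01 e_out e_ab [de_left de_right]]]] := exists_bump ca (ltW ab) bd.
have [f [df [Cf f01 _ f_left f_right]]] := exists_ramp ab.
pose g x := f x + f x - 1.
have Cg : C1_derive g (fun x => df x + df x - 0).
  by apply: C1_deriveB (C1_derive_cst 1); exact: C1_deriveD.
have g1 x : `|g x| <= 1 by rewrite ler_norml /g; have := f01 x; lra.
have g_left x : x <= a -> g x = -1 by move=> /f_left[fx _]; rewrite /g fx; ring.
have g_right x : b <= x -> g x = 1 by move=> /f_right[fx _]; rewrite /g fx; ring.
have Cphi := test_fun_C1_derive tphi.
have Cpsi := C1_deriveD Cphi (C1_deriveM Ce (C1_deriveB Cg Cphi)).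
pose psi x := phi x + e x * (g x - phi x).
have dpsiE x : psi^`()%classic x - phi^`()%classic x =
    de x * (g x - phi x) + e x * (2 * df x - phi^`()%classic x).
  by rewrite (C1_derive_derive1 Cpsi); ring.
exists psi; split.
- by apply: (test_fun_interpolate tphi Ce Cg c0 dT) => // x /e_out[].
- by rewrite /psi e_ab ?lexx ?ltW// mul1r addrC subrK g_left.
- by rewrite /psi e_ab ?lexx ?ltW// mul1r addrC subrK g_right.
- move=> x /e_out[ex dex]; apply/eqP; rewrite -subr_eq0 dpsiE ex dex.
  by rewrite !mul0r addr0.
- move=> x x_out; rewrite dpsiE.
  have -> : df x = 0 by case: x_out => [/f_left|/f_right] [].
  have slope_le0 : de x * (g x - phi x) <= 0.
    have := phi1 x; rewrite ler_norml => /andP[phi_ge phi_le].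
    case: x_out => [xa|bx].
      by rewrite g_left// mulr_ge0_le0 ?de_left//; lra.
    by rewrite g_right// mulr_le0_ge0 ?de_right//; lra.
  rewrite mulr0 sub0r mulrN -lerBrDr (le_trans slope_le0)//.
  have /andP[ex0 ex1] := e01 x.
  rewrite subr_ge0 (le_trans (ler_norm _))// normrN normrM (ger0_norm ex0).
  by rewrite ler_piMl.
Qed.

End TotalVariation.

Section Plateau.
Context {R : realType}.
Variables (T : R) (v : R -> R) (c a b d m : R).
Notation mu := (@lebesgue_measure R).
Hypothesis iv : isL1 T v.
Hypotheses (c0 : 0 < c) (ca : c < a) (ab : a < b) (bd : b < d) (dT : d < T).
Hypothesis v_plateau : {ae mu, forall x, `]a, b[%classic x -> v x = m}.
Hypothesis v_le : {ae mu, forall x, `]c, d[%classic x -> v x <= m}.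
Implicit Types (phi psi : R -> R) (l r C eps : R).

Definition flanks l r : set R := `]l, a]%classic `|` `[b, r[%classic.

Lemma measurable_flanks l r : measurable (flanks l r : set (measurableTypeR R)).
Proof. by apply: measurableU; exact: measurable_itv. Qed.

Lemma flanks_sub l r : c <= l -> r <= d -> flanks l r `<=` oitv T.
Proof.
move=> cl rd; have aT := lt_trans ab (lt_trans bd dT).
have b0 := lt_trans c0 (lt_trans ca ab).
rewrite subUset; split; apply: subset_itv; rewrite bnd_simp//.
- exact: ltW (lt_le_trans c0 cl).
- exact: le_trans rd (ltW dT).
Qed.

Lemma le_mu_flanks l r : l < a -> b < r ->
  (mu (flanks l r) <= ((a - l) + (r - b))%:E)%E.
Proof.
move=> la br; apply: (le_trans (measureU2 _ _ _)); try exact: measurable_itv.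
rewrite EFinD; apply: leeD; rewrite /= lebesgue_measure_itv/= lte_fin.
  by rewrite la.
by rewrite br.
Qed.

Lemma exists_small_flanks eps : 0 < eps -> exists l r,
  [/\ c <= l < a, b < r <= d & \int[mu]_(x in flanks l r) `|v x - m| < eps].
Proof.
move=> eps0.
have iw : isL1 T (fun x => v x + - m).
  by apply: isL1D => //; exact/isL1_continuous/cst_continuous.
have [delta delta0 small] :=
  Rintegral_normr_abs_continuous (@measurable_oitv R T) iw eps0.
exists (Num.max c (a - delta / 3)), (Num.min d (b + delta / 3)).
set l := Num.max _ _; set r := Num.min _ _.
have [cl la al] : [/\ c <= l, l < a & a - l <= delta / 3].
  split; first by rewrite le_max lexx.
    by rewrite gt_max ca ltrBlDr ltrDl divr_gt0.
  by rewrite lerBlDr -lerBlDl le_max lexx orbT.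
have [rd br rb] : [/\ r <= d, b < r & r - b <= delta / 3].
  split; first by rewrite ge_min lexx.
    by rewrite lt_min bd ltrDl divr_gt0.
  by rewrite lerBlDl ge_min lexx orbT.
split; [exact/andP|exact/andP|apply: small].
- exact: measurable_flanks.
- exact: flanks_sub.
- apply: le_lt_trans (le_mu_flanks la br) _; rewrite lte_fin; lra.
Qed.

Lemma flank_increment_ge l r C p x : c <= l -> r <= d -> 0 <= C ->
  (`]a, b[%classic x -> v x = m) -> (`]c, d[%classic x -> v x <= m) ->
  (x <= l \/ r <= x -> p = 0) -> (x <= a \/ b <= x -> p <= C) ->
  - C * (\1_(flanks l r) x * `|v x - m|) <= p * (v x - m).
Proof.
move=> cl rd C0 v_plateau_x v_le_x p_out p_le.
have lhs_le0 : - C * (\1_(flanks l r) x * `|v x - m|) <= 0.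
  by rewrite mulNr oppr_le0 !mulr_ge0// indicE.
have [xl|lx] := leP x l; first by rewrite p_out ?mul0r//; left.
have [rx|xr] := leP r x; first by rewrite p_out ?mul0r//; right.
have [xab|/negP xNab] := boolP (x \in `]a, b[).
  by rewrite v_plateau_x// subrr normr0 !mulr0.
have flank_x : flanks l r x.
  move: xNab; rewrite /flanks /= !in_itv/= lx xr andbT => /negP.
  by rewrite negb_and -!leNgt => /orP[->|->]; [left|right].
have w_le0 : v x - m <= 0.
  by rewrite subr_le0 v_le_x//= in_itv/= (le_lt_trans cl lx) (lt_le_trans xr rd).
rewrite indicE mem_set// mul1r (ler0_norm w_le0) mulrNN ler_wnM2r// p_le//.
by case: flank_x; rewrite /= in_itv/= => /andP[? ?]; [left|right].
Qed.

(* Derivatives of test functions have integral 0, so [v] may be replaced by [v - m],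
   which vanishes on the plateau and is nonpositive on the flanks. *)
Lemma pairing_derive1_ge phi psi l r C :
  test_fun T phi -> test_fun T psi -> c <= l < a -> b < r <= d ->
  {ae mu, forall x, oitv T x -> `|phi^`()%classic x| <= C} ->
  (forall x, x <= l \/ r <= x -> psi^`()%classic x = phi^`()%classic x) ->
  (forall x, x <= a \/ b <= x ->
    psi^`()%classic x - phi^`()%classic x <= `|phi^`()%classic x|) ->
  pairing T v phi^`()%classic - C * \int[mu]_(x in flanks l r) `|v x - m| <=
  pairing T v psi^`()%classic.
Proof.
move=> tphi tpsi /andP[cl la] /andP[br rd] phiC psi_out psi_slope.
have im : isL1 T (fun=> - m) by exact/isL1_continuous/cst_continuous.
pose w := v \+ (fun=> - m).
have iw : isL1 T w by exact: isL1D.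
have pairing_w f : test_fun T f ->
    pairing T v f^`()%classic = pairing T f^`()%classic w.
  move=> tf; rewrite pairingC pairingDr//; last exact: test_fun_derive1_isLinf.
  by rewrite test_fun_pairing_cst// addr0.
have iphi := test_fun_derive1_isLinf tphi.
have ipsi := test_fun_derive1_isLinf tpsi.
have iflank : isL1 T (\1_(flanks l r) \* (fun x => `|w x|)).
  apply: isL1_mul; last exact: isL1_norm.
  by apply: isLinf_indic; exact: measurable_flanks.
rewrite !pairing_w// lerBlDr -lerBlDl -lerN2 opprB -pairingBl// -mulNr.
rewrite -(@pairing_indic _ T); last exact: flanks_sub.
rewrite pairingC -RintegralZl//; apply: ae_le_Rintegral => //.
- exact: isL1Z.
- by apply: isL1_mul => //; exact: isLinfB.
apply: filterS3 v_plateau v_le phiC => x v_plateau_x v_le_x + Tx => /(_ Tx) phiCx.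
apply: flank_increment_ge => // [|x_out|x_out].
- exact: le_trans phiCx.
- by rewrite /= psi_out// subrr.
- exact: le_trans (psi_slope x x_out) phiCx.
Qed.

Lemma exists_plateau_competitor phi eps : test_fun T phi -> 0 < eps ->
  exists psi, [/\ test_fun T psi, psi a = -1, psi b = 1 &
    pairing T v phi^`()%classic - eps <= pairing T v psi^`()%classic].
Proof.
move=> tphi eps0; have [_ [M phiM]] := test_fun_derive1_isLinf tphi.
pose C := `|M| + 1; have C0 : 0 < C by rewrite ltr_wpDl.
have phiC : {ae mu, forall x, oitv T x -> `|phi^`()%classic x| <= C}.
  apply: filterS phiM => x + Tx => /(_ Tx) /le_trans; apply.
  by rewrite ler_wpDr// ler_norm.
have [l [r [cla brd small]]] := exists_small_flanks (divr_gt0 eps0 C0).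
have [/andP[cl la] /andP[br rd]] := (cla, brd).
have [psi [tpsi psia psib psi_out psi_slope]] :=
  exists_test_fun_rising tphi (lt_le_trans c0 cl) la ab br (le_lt_trans rd dT).
exists psi; split=> //.
apply: le_trans (pairing_derive1_ge _ _ cla brd phiC _ _) => //.
by rewrite lerB// mulrC -ler_pdivlMr// ltW.
Qed.

Lemma TV_raise_plateau k :
  (TV T v + (2 * k)%:E <= TV T (v \+ (k \*o \1_(`]a, b[%classic)))%R)%E.
Proof.
rewrite -leeBrDr//; apply: ge_ereal_sup => _ [phi tphi <-].
apply/lee_addgt0Pr => eps eps0; rewrite -leeBlDr// leeBrDr//.
have [psi [tpsi psia psib le_psi]] := exists_plateau_competitor tphi eps0.
apply: le_trans (pairing_le_TV _ tpsi).
have ipsi := test_fun_derive1_isLinf tpsi.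
have iI := isL1_indic_itvoo T a b.
have jump : pairing T psi^`()%classic \1_(`]a, b[%classic) = 2.
  have a0 := ltW (lt_trans c0 ca); have bT := ltW (lt_trans bd dT).
  rewrite pairing_indic; last exact: itvoo_sub_oitv.
  by rewrite (C1_derive_Rintegral ab (test_fun_C1_derive tpsi)) psia psib opprK.
rewrite pairingC pairingDr//; last exact: isL1Z.
by rewrite pairingZr// jump pairingC -EFinB -EFinD lee_fin mulrC lerD2r.
Qed.

End Plateau.

Lemma TV_lower_plateau (R : realType) (T : R) (u : R -> R) (c a b d m n : R) :
  isL1 T u -> 0 < c -> c < a -> a < b -> b < d -> d < T ->
  {ae @lebesgue_measure R, forall x, `]a, b[%classic x -> u x = m} ->
  {ae @lebesgue_measure R, forall x,
    `]c, d[%classic x -> ~ `]a, b[%classic x -> u x <= n} ->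
  (TV T (u \+ ((n - m) \*o \1_(`]a, b[%classic)))%R + (2 * (m - n))%:E <= TV T u)%E.
Proof.
move=> iu c0 ca ab bd dT u_plateau u_le.
set I : R -> R := \1_(`]a, b[%classic); pose v := u \+ ((n - m) \*o I).
have I_in x : `]a, b[%classic x -> I x = 1.
  by move=> x_in; rewrite /I indicE mem_set.
have I_out x : ~ `]a, b[%classic x -> I x = 0.
  by move=> x_out; rewrite /I indicE memNset.
have iv : isL1 T v by exact/(isL1D iu)/isL1Z/isL1_indic_itvoo.
have v_plateau : {ae @lebesgue_measure R, forall x, `]a, b[%classic x -> v x = n}.
  apply: filterS u_plateau => x ux x_in.
  by rewrite /v /= ux// I_in// mulr1 addrC subrK.
have v_le : {ae @lebesgue_measure R, forall x, `]c, d[%classic x -> v x <= n}.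
  apply: filterS2 v_plateau u_le => x vx ux x_cd.
  have [/vx->//|x_out] := pselect (`]a, b[%classic x).
  by rewrite /v /= I_out// mulr0 addr0 ux.
have uE : v \+ ((m - n) \*o I) = u by apply/funext => x; rewrite /v /=; ring.
by have := TV_raise_plateau iv c0 ca ab bd dT v_plateau v_le (m - n); rewrite uE.
Qed.

Lemma lteD_pmul2l (R : realFieldType) (x y b k : R) (p q : \bar R) :
  0 < b -> q \is a fin_num -> (p + k%:E <= q)%E -> x < y + b * k ->
  (x%:E + b%:E * p < y%:E + b%:E * q)%E.
Proof.
move=> b0 /fineK <-; move: (fine q) => r; rewrite -leeBrDr// -EFinB => pr xy.
apply: (@le_lt_trans _ _ (x%:E + b%:E * (r - k)%:E)%E).
  by rewrite leeD2l// lee_pmul2l// lte_fin.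
rewrite -!EFinM -!EFinD lte_fin mulrBr; lra.
Qed.

Lemma increasing_mono_range (disp : Order.disp_t) (X : porderType disp) (d : nat)
    (nu : nat -> X) : (forall k, (1 <= k < d)%N -> (nu k < nu k.+1)%O) ->
  {in [pred k | 1 <= k <= d]%N &, {mono nu : k l / (k <= l)%N >-> (k <= l)%O}}.
Proof.
move=> nu_lt; apply: Order.NatMonotonyTheory.incn_inP.
  move=> k l /[!inE] /andP[k1 kd] /andP[_ ld] n /andP[kn nl]; rewrite inE.
  by rewrite (leq_trans k1 (ltnW kn)) (leq_trans (ltnW nl) ld).
by move=> k /[!inE] /andP[k1 _] /andP[_ kd]; rewrite nu_lt// k1.
Qed.

Lemma Uad_le_pred_off_plateau (R : realType) (T : R) (d : nat) (nu : nat -> int)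
    (u : R -> R) (j : nat) (t1 t2 t3 t4 : R) :
  (forall i : nat, (1 <= i < d)%N -> nu i < nu i.+1) -> Uad T d nu u ->
  (2 <= j <= d)%N -> 0 <= t1 -> t4 <= T ->
  {ae @lebesgue_measure R, forall x, (`]t1, t2[%classic `|` `]t3, t4[%classic) x ->
    u x < (nu j)%:~R} ->
  {ae @lebesgue_measure R, forall x, `]t1, t4[%classic x ->
    ~ `]t2, t3[%classic x -> u x <= (nu j.-1)%:~R}.
Proof.
move=> nu_lt [_ uU] /andP[j2 jd] t10 t4T u_flank.
have nu_mono := increasing_mono_range nu_lt.
have j1 : (1 <= j)%N := ltnW j2.
have j_in : j \in [pred k | 1 <= k <= d]%N by rewrite inE j1.
have pred_in : j.-1 \in [pred k | 1 <= k <= d]%N.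
  by rewrite inE -ltnS prednK// j2 (leq_trans (leq_pred j)).
apply: filterS3 (filterI (ae_neq t2) (ae_neq t3)) u_flank uU.
move=> x [x_neq2 x_neq3] u_lt u_val x14 xN23.
have [i [i_in uxE]] := u_val (itvoo_sub_oitv t10 t4T x14).
have : u x < (nu j)%:~R.
  apply: u_lt; move: x14 xN23; rewrite /= !in_itv/= => /andP[-> ->] /negP.
  rewrite negb_and -!leNgt andbT => /orP[x2|x3]; [left|right].
    by rewrite lt_neqAle x_neq2.
  by rewrite lt_neqAle eq_sym x_neq3.
rewrite uxE ltr_int ler_int (leW_mono_in nu_mono) ?inE// nu_mono ?inE// => ij.
by rewrite -ltnS prednK.
Qed.

Unset Implicit Arguments.

Theorem theorem3p12 (R : realType) (T beta L : R) (d : nat) (nu : nat -> int)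
  (F : (R -> R) -> R) (G : (R -> R) -> R -> R)
  (u : R -> R) (j : nat) (t1 t2 t3 t4 : R) :
  0 < T -> 0 < beta ->
  (forall i : nat, (1 <= i < d)%N -> nu i < nu i.+1) ->
  frechet_grad T F G -> 0 <= L -> grad_lipschitz T G L ->
  Uad T d nu u -> isBV T u ->
  (2 <= j <= d)%N ->
  0 < t1 -> t1 < t2 -> t2 < t3 -> t3 < t4 -> t4 < T ->
  {ae @lebesgue_measure R, forall x, `]t2, t3[%classic x -> u x = (nu j)%:~R} ->
  {ae @lebesgue_measure R, forall x, (`]t1, t2[%classic `|` `]t3, t4[%classic) x ->
      u x < (nu j)%:~R} ->
  - 2 * beta - Rintegral (@lebesgue_measure R) `]t2, t3[%classic (G u)
    + L / 2 * ((nu j)%:~R - (nu j.-1)%:~R) * (t3 - t2) ^+ 2 < 0 ->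
  let v := fun x => u x + ((nu j.-1)%:~R - (nu j)%:~R) * \1_(`]t2, t3[%classic) x in
  ((F v)%:E + beta%:E * TV T v < (F u)%:E + beta%:E * TV T u)%E.
Proof.
move=> T0 beta0 nu_lt FG _ GL Uu [iu TVu] j2d t10 t12 t23 t34 t4T.
move=> u_plateau u_flank crit.
have t20 := ltW (lt_trans t10 t12); have t3T := ltW (lt_trans t34 t4T).
have nu_pred_lt : (nu j.-1)%:~R < (nu j)%:~R :> R.
  case/andP: j2d => j2 jd; have jK : j.-1.+1 = j by exact/prednK/ltnW.
  by rewrite ltr_int -[in ltRHS]jK nu_lt// -ltnS jK j2.
have u_le := Uad_le_pred_off_plateau nu_lt Uu j2d (ltW t10) (ltW t4T) u_flank.
have TV_drop := TV_lower_plateau iu t10 t12 t23 t34 t4T u_plateau u_le.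
have F_le := descent_indic_itvoo FG GL
  ((nu j.-1)%:~R - (nu j)%:~R) iu t20 (ltW t23) t3T.
apply: lteD_pmul2l beta0 _ TV_drop _.
  by rewrite fin_numElt TVu andbT (lt_le_trans _ (TV_ge0 u T0))// ltNyr.
apply: le_lt_trans F_le _.
have gap0 : 0 < (nu j)%:~R - (nu j.-1)%:~R :> R by rewrite subr_gt0.
by move: crit; rewrite -(pmulr_rlt0 _ gap0); lra.
Qed.
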